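(* Let $A,M\in\mathbb{C}^{n\times n}$ be non-singular matrices such that $M^{-1}A$ is diagonalizable. Let $\hat{\mathbf v}_i$ and $\check{\mathbf v}_i$, $i=1,\dots,n$, be the right and left generalized eigenvectors of the matrix pencil $(A,M)$ corresponding to the eigenvalue $\lambda_i$, with the eigenvalues ordered such that $$|1-\lambda_1|\ge|1-\lambda_2|\ge\cdots\ge|1-\lambda_n|.$$ Consider inter-grid transfer operators $P,R^*\in\mathbb{C}^{n\times n_c}$ defined to span some set of $n_c$ right and left generalized eigenvectors, respectively; that is, let $\mathcal T$ be the set of all pairs $(P,R)$ for which there is a subset $\mathcal I\subseteq\{1,\dots,n\}$ with $|\mathcal I|=n_c$ such that $$\operatorname{range}(P)=\operatorname{span}\{\hat{\mathbf v}_\ell:\ell\in\mathcal I\},\qquad\operatorname{range}(R^* )=\operatorname{span}\{\check{\mathbf v}_\ell:\ell\in\mathcal I\}.$$ Let the optimal interpolation $P_\sharp$ and optimal restriction $R_\sharp$, with $P_\sharp,R_\sharp^*\in\mathbb{C}^{n\times n_c}$, satisfy $$\operatorname{range}(P_\sharp)=\operatorname{span}\{\hat{\mathbf v}_1,\dots,\hat{\mathbf v}_{n_c}\},\qquad \operatorname{range}(R_\sharp^* )=\operatorname{span}\{\check{\mathbf v}_1,\dots,\check{\mathbf v}_{n_c}\}.$$ Then, over this space of transfer operators, $P_\sharp$ and $R_\sharp$ minimize the spectral radius of the two-grid error transfer operator $E_{TG}(P,R)=(I-P(RAP)^{-1}RA)(I-M^{-1}A)$, i.e., $$\min_{(P,R)\in\mathcal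 T}\rho\left(E_{TG}(P,R)\right)=\rho\left(E_{TG}(P_\sharp,R_\sharp)\right)=|1-\lambda_{n_c+1}|.$$
   Context: $(\cdot)^*$ denotes the conjugate transpose and $\rho(\cdot)$ the spectral radius. The coarse dimension satisfies $n_c<n$. The matrices $V_r=[\hat{\mathbf v}_1,\dots,\hat{\mathbf v}_n]$ and $V_l=[\check{\mathbf v}_1,\dots,\check{\mathbf v}_n]$ of right and left generalized eigenvectors (full sets of $n$ linearly independent eigenvectors) are defined by $$AV_r=MV_r\Lambda,\qquad V_l^*A=\Lambda V_l^*M,$$ with $\Lambda=\operatorname{diag}(\lambda_1,\dots,\lambda_n)$.
   Formalization: The minimum is over pairs in T with RAP nonsingular, and R♯AP♯ is assumed nonsingular; for repeated eigenvalues with unpaired eigenvectors RAP can be singular. RAP is proved nonsingular on all of T when eigenvalues are distinct or eigenvectors are paired. *)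

(* Defs.v *)
From HB Require Import structures.
From mathcomp Require Import all_boot all_order all_algebra.
From mathcomp Require Import complex.
From mathcomp Require Import boolp classical_sets reals.

Set Implicit Arguments.
Unset Strict Implicit.
Unset Printing Implicit Defensive.

Import Order.TTheory GRing.Theory Num.Theory.

Local Open Scope ring_scope.
Local Open Scope complex_scope.
Local Open Scope sesquilinear_scope.

(* The norm `|z| of R[i] lands in R[i]; this is the modulus as an element of R. *)
Definition modulus (R : realType) (z : R[i]) : R := Normc.normc z.

Definition spectral_radius (R : realType) (n : nat) (B : 'M[R[i]]_n) : R :=
  sup [set modulus a | a in [set a | eigenvalue B a]]%classic.

(* MathComp subspaces are row spaces, so column spaces are handled through
   transposes: the rows of colspan V I span { (v_l)^T : l in I }. *)
Definition colspan (R : realType) (n m : nat) (V : 'M[R[i]]_(n, m))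
    (I : {set 'I_m}) : 'M[R[i]]_n :=
  (\sum_(l in I) <<(col l V)^T>>)%MS.

Definition range_is_span (R : realType) (n k m : nat) (P : 'M[R[i]]_(n, k))
    (V : 'M[R[i]]_(n, m)) (I : {set 'I_m}) : Prop :=
  (P^T == colspan V I)%MS.

(* I - P (RAP)^-1 R A is only meaningful when Rs *m A *m P \in unitmx
   (invmx returns its argument on singular matrices). *)
Definition E_TG (R : realType) (n nc : nat) (A M : 'M[R[i]]_n)
    (P : 'M[R[i]]_(n, nc)) (Rs : 'M[R[i]]_(nc, n)) : 'M[R[i]]_n :=
  (1%:M - P *m invmx (Rs *m A *m P) *m Rs *m A) *m (1%:M - invmx M *m A).

Definition transfer_pair (R : realType) (n nc : nat) (Vr Vl : 'M[R[i]]_n)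
    (P : 'M[R[i]]_(n, nc)) (Rs : 'M[R[i]]_(nc, n)) : Prop :=
  exists I : {set 'I_n},
    [/\ #|I| = nc, range_is_span P Vr I & range_is_span (Rs^t*) Vl I].

Definition is_min (R : realType) (S : set R) (x : R) : Prop :=
  S x /\ lbound S x.

(* Main.v *)
Require Import Defs.
From HB Require Import structures.
From mathcomp Require Import all_boot all_order all_algebra.
From mathcomp Require Import complex.
From mathcomp Require Import boolp classical_sets reals.

Set Implicit Arguments.
Unset Strict Implicit.
Unset Printing Implicit Defensive.

Import Order.TTheory GRing.Theory Num.Theory.

Local Open Scope ring_scope.
Local Open Scope complex_scope.
Local Open Scope sesquilinear_scope.

(** In the basis of right eigenvectors, the coarse-grid correction
    [1 - P (RAP)^-1 R A] annihilates the eigenvectors indexed by [I], and the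
    rows of [Vr^-1] indexed outside [I] annihilate its projection part because
    they annihilate [P].  Those rows are therefore left eigenvectors of the
    two-grid operator for [1 - lam_j], and every other eigenvalue is [0]: the
    spectral radius is the largest [|1 - lam_j|] with [j] outside [I], whatever
    the coupling between left and right eigenvectors.  As [#|I| = nc], some
    [j <= nc] (counting from 0) lies outside [I]. *)

Section GeneralizedEigenvectors.

Variable R : realType.

(** * Conjugate transposes, column spans and spectral radii *)

Lemma trmxCM n m p (B : 'M[R[i]]_(n, m)) (C : 'M[R[i]]_(m, p)) :
  (B *m C)^t* = C^t* *m B^t*.
Proof. by rewrite trmx_mul map_mxM. Qed.

Lemma col_mulmx n m p (B : 'M[R[i]]_(n, m)) (C : 'M[R[i]]_(m, p)) (j : 'I_p) :
  col j (B *m C) = B *m col j C.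
Proof. by rewrite !colE mulmxA. Qed.

Lemma unitmx_trmxC n (B : 'M[R[i]]_n) : (B^t* \in unitmx) = (B \in unitmx).
Proof. by rewrite map_unitmx unitmx_tr. Qed.

(** Row [j] of [invmx V] is dual to the columns of [V], so it kills those indexed by [I], which span
    the range of [P]. *)
Lemma range_is_span_coord n k (P : 'M[R[i]]_(n, k)) (V : 'M[R[i]]_n)
    (I : {set 'I_n}) (j : 'I_n) :
  V \in unitmx -> range_is_span P V I -> j \notin I ->
  row j (invmx V) *m P = 0.
Proof.
move=> hV /andP[sPI _] jI; apply: trmx_inj; rewrite trmx0 trmx_mul.
apply/sub_kermxP/(submx_trans sPI)/sumsmx_subP => l lI.
rewrite genmxE; apply/sub_kermxP; rewrite -trmx_mul.
rewrite -col_mulmx -row_mul mulVmx //; apply/matrixP => x y; rewrite !mxE.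
by case: eqP jI => // ->; rewrite lI.
Qed.

Lemma range_is_span_col n k (P : 'M[R[i]]_(n, k)) (V : 'M[R[i]]_n)
    (I : {set 'I_n}) (i : 'I_n) :
  range_is_span P V I -> i \in I -> exists x : 'cV_k, col i V = P *m x.
Proof.
move=> /andP[_ sIP] iI.
have /submxP[x ex] : ((col i V)^T <= P^T)%MS.
  by apply/(submx_trans _ sIP)/(sumsmx_sup i) => //; rewrite genmxE.
by exists x^T; apply: trmx_inj; rewrite ex trmx_mul trmxK.
Qed.

(** Subadditivity bounds each rank by the cardinal; the spans for [I] and its complement together
    fill the space, so the bound is attained. *)
Lemma rank_colspan n (V : 'M[R[i]]_n) (I : {set 'I_n}) :
  V \in unitmx -> \rank (colspan V I) = #|I|.
Proof.
move=> hV; have rank_le (J : {set 'I_n}) : (\rank (colspan V J) <= #|J|)%N.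
  rewrite -sum1_card; apply: leq_trans (mxrank_sum_leqif _) _ => /=.
  by apply: leq_sum => l _; rewrite genmxE rank_leq_row.
have full : (n <= \rank (colspan V I + colspan V (~: I))%MS)%N.
  rewrite -{1}(mxrank_unit hV) -mxrank_tr.
  apply/mxrankS/row_subP => l; rewrite -tr_col.
  have [lI|lI] := boolP (l \in I).
    apply/(submx_trans _ (addsmxSl _ _))/(sumsmx_sup l) => //.
    by rewrite genmxE.
  apply/(submx_trans _ (addsmxSr _ _))/(sumsmx_sup l); rewrite ?inE //.
  by rewrite genmxE.
apply/eqP; rewrite eqn_leq rank_le /= -(leq_add2r #|~: I|) cardsC card_ord.
apply: leq_trans full (leq_trans (mxrank_adds_leqif _ _) _).
by rewrite leq_add2l rank_le.
Qed.

Lemma range_is_span_row_free n (V : 'M[R[i]]_n) (I : {set 'I_n}) k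
    (P : 'M[R[i]]_(n, k)) :
  V \in unitmx -> #|I| = k -> range_is_span P V I -> row_free P^T.
Proof.
by move=> hV cI /eqmxP rP; rewrite /row_free rP rank_colspan // cI.
Qed.

Lemma spectral_radius_max n (B : 'M[R[i]]_n) (a : R[i]) :
  eigenvalue B a -> (forall b, eigenvalue B b -> modulus b <= modulus a) ->
  spectral_radius B = modulus a.
Proof.
move=> Ba maxa; apply/le_anti/andP; split.
  by apply: ge_sup => [|_ [b Bb <-]]; [exists (modulus a), a | exact: maxa].
apply: ub_le_sup; last by exists a.
by exists (modulus a) => _ [b Bb <-]; exact: maxa.
Qed.

Lemma modulus_ge0 (z : R[i]) : 0 <= modulus z.
Proof. by case: z => x y; rewrite sqrtr_ge0. Qed.

(** * Biorthogonality and the coarse operator *)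

Section ErrorOperator.

Variables (n nc : nat) (A M Vr Vl : 'M[R[i]]_n) (lam : 'rV[R[i]]_n).
Hypotheses (hA : A \in unitmx) (hM : M \in unitmx).
Hypotheses (hVr : Vr \in unitmx) (hVl : Vl \in unitmx).
Hypothesis hright : A *m Vr = M *m Vr *m diag_mx lam.
Hypothesis hleft : Vl^t* *m A = diag_mx lam *m Vl^t* *m M.

(** Evaluating [Vl^t* *m A *m Vr] from both sides shows that [N] commutes with [diag_mx lam], which
    settles distinct eigenvalues; [paired] covers equal ones. *)
Lemma left_right_eigenvectors_biorthogonal :
  (forall i j : 'I_n, i != j -> lam 0 i = lam 0 j ->
     (col i Vl)^t* *m M *m col j Vr = 0) ->
  forall i j : 'I_n, i != j -> (Vl^t* *m M *m Vr) i j = 0.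
Proof.
move=> paired i j ij; set N := Vl^t* *m M *m Vr.
have [eqlam|neqlam] := eqVneq (lam 0 i) (lam 0 j).
  have := paired i j ij eqlam.
  rewrite tr_col map_row -row_mul -col_mulmx -row_mul -/N.
  by move=> /matrixP/(_ 0 0); rewrite !mxE.
have comm : diag_mx lam *m N = N *m diag_mx lam.
  transitivity (Vl^t* *m A *m Vr); first by rewrite hleft !mulmxA.
  by rewrite -[LHS]mulmxA hright !mulmxA.
have := congr1 (fun B : 'M_n => B i j) comm.
rewrite mul_diag_mx mul_mx_diag !mxE => /eqP.
rewrite mulrC -subr_eq0 -mulrBr mulf_eq0 subr_eq0 (negPf neqlam) orbF.
by move/eqP.
Qed.

Lemma coarse_operator_unit (P : 'M[R[i]]_(n, nc)) (Rs : 'M[R[i]]_(nc, n)) :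
  (forall i j : 'I_n, i != j -> lam 0 i = lam 0 j ->
     (col i Vl)^t* *m M *m col j Vr = 0) ->
  transfer_pair Vr Vl P Rs -> Rs *m A *m P \in unitmx.
Proof.
move=> /left_right_eigenvectors_biorthogonal orth [I [cI rP rR]].
rewrite -row_free_unit; apply: inj_row_free => u uRAP0.
have hVlC : Vl^t* \in unitmx by rewrite unitmx_trmxC.
(* Coordinates of [u *m Rs] in the basis of left eigenvectors; they are supported on [I]. *)
pose d := u *m Rs *m invmx (Vl^t*).
have dE : u *m Rs = d *m Vl^t* by rewrite /d mulmxKV.
have d0 j : j \notin I -> d 0 j = 0.
  move=> jI; have Rj0 : Rs *m col j (invmx (Vl^t*)) = 0.
    have /(congr1 (fun B => B^t*)) := range_is_span_coord hVl rR jI.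
    by rewrite trmxCM trmxCK trmx0 map_mx0 tr_row map_col trmx_inv map_invmx.
  have : col j d = 0 by rewrite /d col_mulmx -mulmxA Rj0 mulmx0.
  by move=> /matrixP/(_ 0 0); rewrite !mxE.
(* Entries in [I] vanish because those eigenvectors lie in the range of [P], the others by
   biorthogonality. *)
have w0 : u *m Rs *m A *m Vr = 0.
  apply/matrixP => x j; rewrite {x}ord1 [RHS]mxE.
  have [jI|jI] := boolP (j \in I).
    have [y ey] := range_is_span_col rP jI.
    have : col j (u *m Rs *m A *m Vr) = 0.
      rewrite col_mulmx ey !mulmxA -2!(mulmxA u) -(mulmxA Rs) mulmxA.
      by rewrite uRAP0 mul0mx.
    by move=> /matrixP/(_ 0 0); rewrite !mxE.
  rewrite dE -mulmxA hright !mulmxA -2!(mulmxA d) mul_mx_diag mxE [X in X * _]mxE.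
  rewrite big1 ?mul0r // => l _; have [->|lj] := eqVneq l j.
    by rewrite d0 // mul0r.
  by rewrite orth // mulr0.
have uR0 : u *m Rs = 0.
  by rewrite -[u *m Rs](mulmxK hA) -[_ *m A](mulmxK hVr) w0 !mul0mx.
have rfR : row_free Rs.
  have := range_is_span_row_free hVl cI rR.
  by rewrite /row_free mxrank_tr mxrank_map mxrank_tr.
by apply: (row_free_inj rfR); rewrite uR0 mul0mx.
Qed.

(** * Spectrum of the two-grid operator *)

Variables (I : {set 'I_n}) (P : 'M[R[i]]_(n, nc)) (Rs : 'M[R[i]]_(nc, n)).
Hypotheses (rP : range_is_span P Vr I) (hRAP : Rs *m A *m P \in unitmx).

Let E := E_TG A M P Rs.

Lemma smoother_eigenvectors :
  (1%:M - invmx M *m A) *m Vr = Vr *m (1%:M - diag_mx lam).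
Proof.
by rewrite mulmxBl mulmxBr mul1mx mulmx1 -mulmxA hright -mulmxA mulKmx.
Qed.

Lemma smoother_col (j : 'I_n) :
  (1%:M - invmx M *m A) *m col j Vr = (1 - lam 0 j) *: col j Vr.
Proof.
rewrite -col_mulmx smoother_eigenvectors mulmxBr mulmx1 mul_mx_diag.
by apply/matrixP => x y; rewrite !mxE mulrBl mul1r mulrC.
Qed.

Lemma E_TG_col_in (i : 'I_n) : i \in I -> E *m col i Vr = 0.
Proof.
move=> iI; rewrite /E /E_TG -(mulmxA _ _ (col i Vr)) (smoother_col i) -scalemxAr.
have [x ->] := range_is_span_col rP iI.
rewrite mulmxA mulmxBl mul1mx -!mulmxA (mulmxA Rs).
by rewrite mulVmx // mulmx1 subrr mul0mx scaler0.
Qed.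

(** When [v *m P = 0] the coarse correction fixes [v], and only the smoother acts. *)
Lemma E_TG_mul_row (v : 'rV[R[i]]_n) (j : 'I_n) :
  v *m P = 0 -> v *m E *m col j Vr = (1 - lam 0 j) *: (v *m col j Vr).
Proof.
move=> vP0; rewrite -(mulmxA v) /E /E_TG -(mulmxA _ _ (col j Vr)).
rewrite (smoother_col j) -!scalemxAr.
by rewrite mulmxBl mul1mx mulmxBr !mulmxA vP0 !mul0mx subr0.
Qed.

Lemma E_TG_eigenvalue (j : 'I_n) : j \notin I -> eigenvalue E (1 - lam 0 j).
Proof.
move=> jI; have vP0 := range_is_span_coord hVr rP jI.
have rVr : row j (invmx Vr) *m Vr = row j 1%:M by rewrite -row_mul mulVmx.
apply/eigenvalueP; exists (row j (invmx Vr)); last first.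
  apply/eqP => v0; have /matrixP/(_ 0 j)/eqP := rVr.
  by rewrite v0 mul0mx !mxE eqxx eq_sym oner_eq0.
apply: (row_free_inj (A := Vr)); first by rewrite row_free_unit.
rewrite -scalemxAl rVr; apply/matrixP => x l; rewrite {x}ord1.
have /matrixP/(_ 0 0) := E_TG_mul_row l vP0.
rewrite -!col_mulmx rVr !mxE => ->; rewrite /=.
by case: eqP => [->|_] //; rewrite !mulr0.
Qed.

(** If [a] is nonzero, a left eigenvector [v] is orthogonal to the columns in [I], which [E] kills.
    Hence [v *m P = 0], and any nonzero entry [j] of [v *m Vr] forces [a = 1 - lam 0 j]. *)
Lemma E_TG_eigenvalue_inv (a : R[i]) :
  eigenvalue E a -> a = 0 \/ exists2 j : 'I_n, j \notin I & a = 1 - lam 0 j.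
Proof.
move=> /eigenvalueP[v vE v0]; have [->|a0] := eqVneq a 0; [by left|right].
pose w := v *m Vr.
have vw : v = w *m invmx Vr by rewrite mulmxK.
have w0 i : i \in I -> w 0 i = 0.
  move=> iI; have := congr1 (mulmx v) (E_TG_col_in iI).
  rewrite mulmxA vE mulmx0 -scalemxAl -col_mulmx => /matrixP/(_ 0 0)/eqP.
  by rewrite !mxE mulf_eq0 (negPf a0) => /eqP.
have vP0 : v *m P = 0.
  rewrite vw -mulmxA mulmx_sum_row big1 // => j _.
  have [jI|jI] := boolP (j \in I); first by rewrite w0 // scale0r.
  by rewrite row_mul (range_is_span_coord hVr rP jI) scaler0.
have /rV0Pn[j wj] : w != 0.
  by apply: contraNneq v0 => w00; rewrite vw w00 mul0mx.
exists j; first by apply: contraNN wj => /w0 ->.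
have := E_TG_mul_row j vP0.
rewrite vE -scalemxAl -col_mulmx => /matrixP/(_ 0 0).
by rewrite !mxE; rewrite mxE in wj; apply: mulIf.
Qed.

Lemma E_TG_spectral_radius (j : 'I_n) : j \notin I ->
  (forall l, l \notin I -> modulus (1 - lam 0 l) <= modulus (1 - lam 0 j)) ->
  spectral_radius E = modulus (1 - lam 0 j).
Proof.
move=> jI maxj; apply: spectral_radius_max; first exact: E_TG_eigenvalue.
move=> b /E_TG_eigenvalue_inv[->|[l lI ->]]; last exact: maxj.
by rewrite /modulus Normc.normc0 modulus_ge0.
Qed.

End ErrorOperator.

End GeneralizedEigenvectors.

(* The eigenvalues are indexed from 0, so lambda_(nc+1) is entry nc of lam.

   If an eigenvalue is repeated, left and right eigenvectors need not be
   paired, and R A P may be singular for some of the transfer pairs (e.g. for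
   A = M = 1, Vr = 1 and Vl a transposition), where the error operator is
   undefined.  The minimum is thus over the pairs with R A P nonsingular; the
   first conjunct says that these are all the pairs as soon as eigenvectors
   of a common eigenvalue are paired, which holds vacuously when the
   eigenvalues are distinct. *)
Theorem corollary5p2 (R : realType) (n nc : nat) (hnc : (nc < n)%N)
    (A M : 'M[R[i]]_n) (hA : A \in unitmx) (hM : M \in unitmx)
    (hdiag : diagonalizable (invmx M *m A))
    (Vr Vl : 'M[R[i]]_n) (lam : 'rV[R[i]]_n)
    (hVr : Vr \in unitmx) (hVl : Vl \in unitmx)
    (hright : A *m Vr = M *m Vr *m diag_mx lam)
    (hleft : Vl^t* *m A = diag_mx lam *m Vl^t* *m M)
    (hord : forall i j : 'I_n, (i <= j)%N ->
       modulus (1 - lam 0 j) <= modulus (1 - lam 0 i))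
    (Psharp : 'M[R[i]]_(n, nc)) (Rsharp : 'M[R[i]]_(nc, n))
    (hPsharp : range_is_span Psharp Vr [set l : 'I_n | (l < nc)%N])
    (hRsharp : range_is_span (Rsharp^t*) Vl [set l : 'I_n | (l < nc)%N]) :
  ((forall i j : 'I_n, i != j -> lam 0 i = lam 0 j ->
      (col i Vl)^t* *m M *m col j Vr = 0) ->
   forall (P : 'M[R[i]]_(n, nc)) (Rs : 'M[R[i]]_(nc, n)),
     transfer_pair Vr Vl P Rs -> Rs *m A *m P \in unitmx)
  /\
  (Rsharp *m A *m Psharp \in unitmx ->
   is_min
     [set r : R | exists (P : 'M[R[i]]_(n, nc)) (Rs : 'M[R[i]]_(nc, n)),
        [/\ transfer_pair Vr Vl P Rs, Rs *m A *m P \in unitmx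
          & r = spectral_radius (E_TG A M P Rs)]]%classic
     (spectral_radius (E_TG A M Psharp Rsharp))
   /\ spectral_radius (E_TG A M Psharp Rsharp)
      = modulus (1 - lam 0 (Ordinal hnc))).
Proof.
split=> [paired P Rs|hRAP].
  exact: (coarse_operator_unit hA hVr hVl hright hleft paired).
set I0 := [set l : 'I_n | (l < nc)%N].
have cI0 : #|I0| = nc.
  have -> : I0 = [set widen_ord (ltnW hnc) l | l in 'I_nc].
    apply/setP => l; rewrite inE; apply/idP/imsetP => [lnc|[m _ ->]] //=.
    by exists (Ordinal lnc); last exact: val_inj.
  by rewrite card_imset ?card_ord // => x y [] /val_inj.
have rho0 : spectral_radius (E_TG A M Psharp Rsharp)
            = modulus (1 - lam 0 (Ordinal hnc)).
  (* Index [nc] is the first one outside [I0], hence dominant there by [hord]. *)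
  apply: (E_TG_spectral_radius hM hVr hright hPsharp hRAP).
    by rewrite inE ltnn.
  by move=> l; rewrite inE -leqNgt => ncl; apply: hord.
split=> //; split; first by exists Psharp, Rsharp; split => //; exists I0.
rewrite rho0 => _ [P [Rs [[I [cI rP _]] hRAP' ->]]].
have [j0 j0I j0nc] : exists2 j : 'I_n, j \notin I & (j <= nc)%N.
  have /fintype.subsetPn[j] : ~~ ([set l : 'I_n | (l < nc.+1)%N] \subset I).
    have lt0 : I0 \proper [set l : 'I_n | (l < nc.+1)%N].
      apply/properP; split; last by exists (Ordinal hnc); rewrite !inE ?ltnn //=.
      by apply/fintype.subsetP => l; rewrite !inE => /ltnW.
    apply/negP => /subset_leq_card.
    by rewrite cI leqNgt -[X in (X < _)%N]cI0 proper_card.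
  by rewrite inE ltnS => jnc jI; exists j.
(* By the ordering, the smallest index outside [I] carries the largest modulus. *)
case: (@arg_minnP _ j0 (fun l => l \notin I) val j0I) => j jI minj.
rewrite (E_TG_spectral_radius hM hVr hright rP hRAP' jI).
  by apply: hord; apply: leq_trans (minj _ j0I) j0nc.
by move=> l lI; apply/hord/minj.
Qed.
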